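(* Let $n,k$ be integers with $1\le k\le n/2$, and consider a dueling teams instance $(P,\succ)$ on the player set $[n]$ with team size $k$. Let $a,b\in[n]$ be two distinct players. Then $a\succ^* b$ if and only if $\mathcal{S}^*_{a,b}\cup\mathcal{T}^*_{a,b}\neq\emptyset$.
   Context: Setting (dueling teams instance). Players are $[n]=\{1,\dots,n\}$; a team is a $k$-element subset of $[n]$. There is a strict total order $\succ$ on all teams (the ground truth order), and for every pair of teams $A,B$ (not only disjoint ones) a winning probability $P_{A,B}\in[0,1]$ with $P_{A,B}=1-P_{B,A}$, such that $A\succ B$ implies $P_{A,B}>1/2$ (and $P_{A,A}=1/2$). Two assumptions: (SST) for all distinct teams $A\succ B\succ C$, $P_{A,C}\ge\max\{P_{A,B},P_{B,C}\}$. (Consistency) for every two distinct players $a,b$, either $S\cup\{a\}\succ S\cup\{b\}$ for all $S\subseteq[n]\setminus\{a,b\}$ with $|S|=k-1$, or $S\cup\{b\}\succ S\cup\{a\}$ for all such $S$; in the first case write $a\succ b$. Only the probabilities $P_{A,B}$ of disjoint teams $A,B$ are observable (via duels). Compatible orders. $\mathbb{P}_{obs}$ is the set of all pairs $(P',\succ')$ where $\succ'$ is a strict total order on teams satisfying Consistency, $P'=(P'_{A,B})$ is a matrix of values in $[0,1]$ indexed by pairs of teams with $P'_{A,B}=1-P'_{B,A}$, $P'_{A,B}=1/2$ iff $A=B$, $P'_{A,B}>1/2$ iff $A\succ' B$, $P'$ satisfies SST with respect to $\succ'$, and $P'_{A,B}=P_{A,B}$ for all disjoint teams $A,B$. $\mathcal{C}_{obs}$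 is the set of all $\succ'$ for which some $(P',\succ')\in\mathbb{P}_{obs}$ exists. Deducible relation. For players, $a\succ^* b$ iff there exists $S\subseteq[n]\setminus\{a,b\}$ with $|S|=k-1$ such that $S\cup\{a\}\succ' S\cup\{b\}$ for all $\succ'\in\mathcal{C}_{obs}$. Witnesses. $\mathcal{S}_{a,b}$ is the set of pairs $(S,S')$ of disjoint subsets of $[n]\setminus\{a,b\}$ with $|S|=|S'|=k-1$; $\mathcal{T}_{a,b}$ is the set of pairs $(S,T)$ of disjoint subsets of $[n]\setminus\{a,b\}$ with $|S|=k-1$, $|T|=k$. $\mathcal{S}^*_{a,b}=\{(S,S')\in\mathcal{S}_{a,b}: P_{S\cup\{a\},S'\cup\{b\}}>P_{S\cup\{b\},S'\cup\{a\}}\}$ and $\mathcal{T}^*_{a,b}=\{(S,T)\in\mathcal{T}_{a,b}: P_{S\cup\{a\},T}>P_{S\cup\{b\},T}\}$. *)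

(* Defs.v *)
From HB Require Import structures.
From mathcomp Require Import all_boot all_order all_algebra.

Set Implicit Arguments.
Unset Strict Implicit.
Unset Printing Implicit Defensive.

Import Order.TTheory GRing.Theory Num.Theory.
Local Open Scope ring_scope.

(* The players are 'I_n.  Relations and matrices on teams are
   total functions on {set 'I_n}, and every axiom below only constrains their
   values at teams; values at sets that are not teams play no role. *)

Definition teams (n k : nat) : {set {set 'I_n}} :=
  [set A : {set 'I_n} | #|A| == k].

Record strict_total_order_on_teams (n k : nat) (gt : rel {set 'I_n}) : Prop :=
  StrictTotalOrderOnTeams {
    gt_irrefl : forall A, A \in teams n k -> ~~ gt A A;
    gt_trans : forall A B C,
      A \in teams n k -> B \in teams n k -> C \in teams n k ->
      gt A B -> gt B C -> gt A C;
    gt_total : forall A B, A \in teams n k -> B \in teams n k ->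
      A != B -> gt A B || gt B A }.

(* The relation a > b between players induced by the order on teams. *)
Definition player_gt (n k : nat) (gt : rel {set 'I_n}) (a b : 'I_n) : Prop :=
  forall S : {set 'I_n}, S \subset ~: [set a; b] -> #|S| = k.-1 ->
    gt (a |: S) (b |: S).

Definition consistent (n k : nat) (gt : rel {set 'I_n}) : Prop :=
  forall a b : 'I_n, a != b -> player_gt k gt a b \/ player_gt k gt b a.

Definition SST (R : realFieldType) (n k : nat)
    (P : {set 'I_n} -> {set 'I_n} -> R) (gt : rel {set 'I_n}) : Prop :=
  forall A B C : {set 'I_n},
    A \in teams n k -> B \in teams n k -> C \in teams n k ->
    uniq [:: A; B; C] -> gt A B -> gt B C ->
    Num.max (P A B) (P B C) <= P A C.

Record dueling_instance (R : realFieldType) (n k : nat)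
    (P : {set 'I_n} -> {set 'I_n} -> R) (gt : rel {set 'I_n}) : Prop :=
  DuelingInstance {
    inst_order : strict_total_order_on_teams k gt;
    inst_prob : forall A B, A \in teams n k -> B \in teams n k ->
      0 <= P A B <= 1;
    inst_sym : forall A B, A \in teams n k -> B \in teams n k ->
      P A B = 1 - P B A;
    inst_diag : forall A, A \in teams n k -> P A A = 1 / 2;
    inst_gt : forall A B, A \in teams n k -> B \in teams n k ->
      gt A B -> 1 / 2 < P A B;
    inst_SST : SST k P gt;
    inst_consistent : consistent k gt }.

Record P_obs (R : realFieldType) (n k : nat)
    (P P' : {set 'I_n} -> {set 'I_n} -> R) (gt' : rel {set 'I_n}) : Prop :=
  InPObs {
    obs_order : strict_total_order_on_teams k gt';
    obs_consistent : consistent k gt';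
    obs_prob : forall A B, A \in teams n k -> B \in teams n k ->
      0 <= P' A B <= 1;
    obs_sym : forall A B, A \in teams n k -> B \in teams n k ->
      P' A B = 1 - P' B A;
    obs_half : forall A B, A \in teams n k -> B \in teams n k ->
      (P' A B = 1 / 2 <-> A = B);
    obs_gt : forall A B, A \in teams n k -> B \in teams n k ->
      (1 / 2 < P' A B <-> gt' A B);
    obs_SST : SST k P' gt';
    obs_agree : forall A B, A \in teams n k -> B \in teams n k ->
      [disjoint A & B] -> P' A B = P A B }.

Definition C_obs (R : realFieldType) (n k : nat)
    (P : {set 'I_n} -> {set 'I_n} -> R) (gt' : rel {set 'I_n}) : Prop :=
  exists P' : {set 'I_n} -> {set 'I_n} -> R, P_obs k P P' gt'.

(* The deducible relation a >* b; it depends on the instance only through P. *)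
Definition deducible (R : realFieldType) (n k : nat)
    (P : {set 'I_n} -> {set 'I_n} -> R) (a b : 'I_n) : Prop :=
  exists S : {set 'I_n},
    [/\ S \subset ~: [set a; b], #|S| = k.-1 &
        forall gt' : rel {set 'I_n}, C_obs k P gt' -> gt' (a |: S) (b |: S)].

Definition Spairs (n k : nat) (a b : 'I_n) : {set {set 'I_n} * {set 'I_n}} :=
  [set p : {set 'I_n} * {set 'I_n} |
   [&& p.1 \subset ~: [set a; b], p.2 \subset ~: [set a; b],
               [disjoint p.1 & p.2], #|p.1| == k.-1 & #|p.2| == k.-1]].

Definition Tpairs (n k : nat) (a b : 'I_n) : {set {set 'I_n} * {set 'I_n}} :=
  [set p : {set 'I_n} * {set 'I_n} |
   [&& p.1 \subset ~: [set a; b], p.2 \subset ~: [set a; b],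
               [disjoint p.1 & p.2], #|p.1| == k.-1 & #|p.2| == k]].

Definition Sstar (R : realFieldType) (n k : nat)
    (P : {set 'I_n} -> {set 'I_n} -> R) (a b : 'I_n) :
    {set {set 'I_n} * {set 'I_n}} :=
  [set p in Spairs k a b |
    P (b |: p.1) (a |: p.2) < P (a |: p.1) (b |: p.2)].

Definition Tstar (R : realFieldType) (n k : nat)
    (P : {set 'I_n} -> {set 'I_n} -> R) (a b : 'I_n) :
    {set {set 'I_n} * {set 'I_n}} :=
  [set p in Tpairs k a b | P (b |: p.1) p.2 < P (a |: p.1) p.2].

(* Main.v *)
(* If a beats b in every order of C_obs then, in particular, a beats b in the
   ground truth.  Let s be the transposition (a b).  Without a witness, all
   probabilities of disjoint teams are s-invariant: one inequality is the
   absence of a witness, the other one is monotonicity (SST).  Hence the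
   s-relabelled instance is compatible with the observations, although b beats
   a in it.  Conversely, in a compatible order where b beats a, monotonicity
   forbids any witness. *)
Require Import Defs.
From mathcomp Require Import all_boot all_order all_algebra all_fingroup.
From mathcomp Require Import lra.

Set Implicit Arguments.
Unset Strict Implicit.
Unset Printing Implicit Defensive.

Import Order.TTheory GRing.Theory Num.Theory.
Local Open Scope ring_scope.

(** * Action of a transposition of two players on teams *)

Lemma teams_setU1 n k (x : 'I_n) (S : {set 'I_n}) : (0 < k)%N ->
  x \notin S -> #|S| = k.-1 -> x |: S \in teams n k.
Proof. by move=> k_gt0 xS cS; rewrite inE cardsU1 xS cS add1n prednK. Qed.

Lemma subsetC2_notin (T : finType) (a b : T) (S : {set T}) :
  S \subset ~: [set a; b] -> (a \notin S) * (b \notin S).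
Proof.
by move=> /subsetP sS; split; apply/negP=> /sS; rewrite !inE eqxx ?orbT.
Qed.

Lemma teams_imset n k (s : {perm 'I_n}) (A : {set 'I_n}) :
  (s @: A \in teams n k) = (A \in teams n k).
Proof. by rewrite !inE card_imset //; apply: perm_inj. Qed.

Lemma imset_tperm_id (T : finType) (a b : T) (A : {set T}) :
  (a \in A) = (b \in A) -> tperm a b @: A = A.
Proof.
move=> eab; apply/eqP; rewrite eqEcard card_imset ?leqnn ?andbT; last first.
  exact: perm_inj.
apply/subsetP=> _ /imsetP[x xA ->].
by case: tpermP => [xa|xb|//]; [rewrite -eab -xa | rewrite eab -xb].
Qed.

Lemma imset_tpermU1 (T : finType) (a b : T) (S : {set T}) :
  S \subset ~: [set a; b] ->
  (tperm a b @: (a |: S) = b |: S) * (tperm a b @: (b |: S) = a |: S).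
Proof.
move=> /subsetC2_notin sS; rewrite !imsetU1 tpermL tpermR imset_tperm_id //.
by rewrite !(negPf sS.1, negPf sS.2).
Qed.

(** These are the three ways in which [tperm a b] can act on [A]: it fixes [A], or it exchanges
    [a |: S] and [b |: S] in one direction or the other. *)
Lemma set_pair_cases (T : finType) (a b : T) (A : {set T}) :
  [\/ (a \in A) = (b \in A),
      exists2 S : {set T}, S \subset ~: [set a; b] & A = a |: S |
      exists2 S : {set T}, S \subset ~: [set a; b] & A = b |: S].
Proof.
case: (boolP (a \in A)) (boolP (b \in A)) => [aA|aA] [bA|bA];
  [by constructor 1 | constructor 2 | constructor 3 | by constructor 1].
- exists (A :\ a); last by rewrite setD1K.
  apply/subsetP=> x; rewrite !inE negb_or => /andP[-> xA] /=.
  by apply: contraNneq bA => <-.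
- exists (A :\ b); last by rewrite setD1K.
  apply/subsetP=> x; rewrite !inE negb_or => /andP[-> xA]; rewrite andbT.
  by apply: contraNneq aA => <-.
Qed.

(** * Compatible pairs: monotonicity, relabelling, and invariance without a witness *)

Section Instances.
Variables (R : realFieldType) (n k : nat).
Implicit Types (P Q : {set 'I_n} -> {set 'I_n} -> R) (gt : rel {set 'I_n}).
Implicit Types (A B C S T : {set 'I_n}).

(** Puts the ground truth among the compatible orders. Totality of [gt] turns the one-way
    implication [inst_gt] into the two equivalences that [P_obs] demands. *)
Lemma dueling_instance_P_obs P gt :
  dueling_instance k P gt -> P_obs k P P gt.
Proof.
case=> ord prob sym diag pgt sst cons; split=> // A B tA tB.
- split=> [PAB|<-]; last exact: diag.
  apply/eqP; apply/negPn/negP=> nAB.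
  case/orP: (gt_total ord tA tB nAB) => /pgt h.
    by have := h tA tB; rewrite PAB ltxx.
  by have := h tB tA; rewrite sym // PAB => ?; lra.
- split=> [PAB|]; last exact: pgt.
  have [eAB|nAB] := eqVneq A B.
    by move: PAB; rewrite eAB diag // ltxx.
  case/orP: (gt_total ord tA tB nAB) => // /pgt h.
  by have := h tB tA; rewrite sym // => ?; lra.
Qed.

Section Compatible.
Variables (P Q : {set 'I_n} -> {set 'I_n} -> R) (gt : rel {set 'I_n}).
Hypothesis obs : P_obs k P Q gt.

Lemma P_obs_asym A B : A \in teams n k -> B \in teams n k ->
  gt A B -> ~~ gt B A.
Proof.
move=> tA tB gAB; apply/negP=> gBA.
by have /negP[] := gt_irrefl (obs_order obs) tA;
   exact: (gt_trans (obs_order obs) tA tB tA gAB gBA).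
Qed.

(** SST compares probabilities only along chains of three distinct teams. Monotonicity against an
    arbitrary opponent [C] follows by locating [C] relative to [A] and [B]. *)
Lemma P_obs_monol A B C :
  A \in teams n k -> B \in teams n k -> C \in teams n k ->
  gt A B -> Q B C <= Q A C.
Proof.
move=> tA tB tC gAB.
have QAB : 1 / 2 < Q A B by apply/(obs_gt obs).
have nAB : A != B.
  by apply: contraTneq gAB => ->; apply: (gt_irrefl (obs_order obs)).
have Q1 D E (tD : D \in teams n k) (tE : E \in teams n k) :=
  obs_sym obs tD tE.
have Qdiag D (tD : D \in teams n k) : Q D D = 1 / 2.
  by apply/(obs_half obs).
have [->|nAC] := eqVneq C A; first by rewrite Q1 // Qdiag //; lra.
have [->|nBC] := eqVneq C B; first by rewrite Qdiag //; lra.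
have /orP[gBC|gCB] : gt B C || gt C B by apply: (gt_total (obs_order obs)); rewrite // eq_sym.
  have u : uniq [:: A; B; C] by rewrite /= !inE !negb_or nAB !(eq_sym _ C) nAC nBC.
  by have := obs_SST obs tA tB tC u gAB gBC; rewrite ge_max => /andP[].
(* From here [C] is above [B]. If [C] is also above [A], SST on the chain [C], [A], [B] gives
   [Q C A <= Q C B], to be complemented; if it lies between them, [1 / 2] separates [Q B C] from
   [Q A C]. *)
have QCB : 1 / 2 < Q C B by apply/(obs_gt obs).
have /orP[gCA|gAC] := gt_total (obs_order obs) tC tA nAC.
  have u : uniq [:: C; A; B] by rewrite /= !inE !negb_or nAB nAC nBC.
  have := obs_SST obs tC tA tB u gCA gAB.
  by rewrite ge_max (Q1 C A) // (Q1 C B) // => /andP[? _]; lra.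
have QAC : 1 / 2 < Q A C by apply/(obs_gt obs).
by move: QCB; rewrite Q1 // => ?; lra.
Qed.

Lemma P_obs_monor A B C :
  A \in teams n k -> B \in teams n k -> C \in teams n k ->
  gt A B -> Q C A <= Q C B.
Proof.
move=> tA tB tC gAB; have := P_obs_monol tA tB tC gAB.
by rewrite (obs_sym obs tC tA) (obs_sym obs tC tB) => ?; lra.
Qed.

Lemma player_gt_imset (s : {perm 'I_n}) a b : player_gt k gt (s a) (s b) ->
  player_gt k (fun A B => gt (s @: A) (s @: B)) a b.
Proof.
move=> pab S /subsetP sS cS; rewrite !imsetU1; apply: pab.
  apply/subsetP=> _ /imsetP[x /sS + ->].
  by rewrite !inE !(inj_eq perm_inj).
by rewrite card_imset //; apply: perm_inj.
Qed.

(** Every axiom but agreement with the observations is invariant under renaming the players, since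
    [s] acts injectively on teams and preserves size; agreement is what the hypothesis supplies. *)
Lemma P_obs_imset (s : {perm 'I_n}) :
  (forall A B, A \in teams n k -> B \in teams n k -> [disjoint A & B] ->
     Q (s @: A) (s @: B) = P A B) ->
  P_obs k P (fun A B => Q (s @: A) (s @: B))
            (fun A B => gt (s @: A) (s @: B)).
Proof.
have inj_s : injective (fun A : {set 'I_n} => s @: A).
  exact: (imset_inj perm_inj).
have ts A : A \in teams n k -> s @: A \in teams n k by rewrite teams_imset.
case: obs => -[irr tr tot] cons prob sym half pgt sst _ agree.
split=> //.
- split=> [A /ts|A B C /ts tA /ts tB /ts|A B /ts tA /ts tB nAB].
  + exact: irr.
  + exact: tr.
  + by apply: tot; rewrite ?(inj_eq inj_s).
- move=> a b nab.
  have nsab : s a != s b by rewrite (inj_eq perm_inj).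
  by case: (cons _ _ nsab) => /player_gt_imset; [left | right].
- by move=> A B /ts tA /ts tB; apply: prob.
- by move=> A B /ts tA /ts tB; apply: sym.
- move=> A B /ts tA /ts tB; split=> [/half|->]; last exact/half.
  by move=> /(_ tA tB)/inj_s.
- by move=> A B /ts tA /ts tB; apply: pgt.
- move=> A B C /ts tA /ts tB /ts tC u; apply: sst => //.
  by rewrite -[[:: _; _; _]]/(map (fun A => s @: A) [:: A; B; C]) map_inj_uniq.
Qed.

End Compatible.

(** Moving [b] to [a] in the left team, or [a] to [b] in the right one, can only help the left team,
    by monotonicity. The opposite moves are controlled by the absence of a witness. *)
Lemma no_witness_tperm_le P Q gt a b : P_obs k P Q gt ->
  a != b -> player_gt k gt a b -> Sstar k Q a b = set0 -> Tstar k Q a b = set0 ->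
  forall A B, A \in teams n k -> B \in teams n k -> [disjoint A & B] ->
    Q A B <= Q (tperm a b @: A) (tperm a b @: B).
Proof.
move=> obs nab pab S0 T0 A B tA tB dAB.
have notin := @subsetC2_notin 'I_n a b.
have sub_out S : (a \in S) = (b \in S) -> a \notin S -> S \subset ~: [set a; b].
  by rewrite subsetC subUset !sub1set !inE => <- ->.
have card_team x S : x |: S \in teams n k -> x \notin S -> #|S| = k.-1.
  by rewrite inE cardsU1 => /eqP <- ->.
have disjP C D x : [disjoint C & D] -> x \in C -> x \notin D.
  by move=> dCD xC; apply/negbT/(disjointFr dCD xC).
have noT S T : S \subset ~: [set a; b] -> a |: S \in teams n k ->
    (a \in T) = (b \in T) -> T \in teams n k -> [disjoint a |: S & T] ->
    Q (a |: S) T <= Q (b |: S) T.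
  move=> sS tS eT tT dST; rewrite leNgt; apply/negP=> lt.
  have aT : a \notin T by apply: disjP dST _; rewrite !inE eqxx.
  suff : (S, T) \in Tstar k Q a b by rewrite T0 inE.
  move: tT; rewrite !inE => cT.
  rewrite /= lt sS sub_out // cT (card_team a) ?notin // eqxx !andbT /=.
  by apply: disjointWl dST; apply: subsetU1.
have up S : S \subset ~: [set a; b] -> a |: S \in teams n k ->
    gt (a |: S) (b |: S).
  by move=> sS tS; apply: pab => //; apply: card_team tS _; rewrite notin.
have rB C D : C \in teams n k -> D \in teams n k -> b \notin D ->
    Q C D <= Q C (tperm a b @: D).
  move=> tC tD bD.
  case: (set_pair_cases a b D) => [eD|[S sS eD]|[S sS eD]].
  - by rewrite imset_tperm_id.
  - have tsD : tperm a b @: D \in teams n k by rewrite teams_imset.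
    rewrite eD imset_tpermU1 // in tD tsD *.
    by apply: (P_obs_monor obs) => //; apply: up.
  - by rewrite eD !inE eqxx in bD.
have tsA : tperm a b @: A \in teams n k by rewrite teams_imset.
have tsB : tperm a b @: B \in teams n k by rewrite teams_imset.
case: (set_pair_cases a b A) => [eA|[S sS eA]|[S sS eA]].
- rewrite (imset_tperm_id eA).
  case: (set_pair_cases a b B) => [eB|[S sS eB]|[S sS eB]].
  + by rewrite imset_tperm_id.
  + by apply: rB; rewrite // eB !inE negb_or eq_sym nab notin.
  + rewrite eB imset_tpermU1 // in tB tsB dAB *.
    (* As [b] is in [B], it is not in [A], hence neither is [a]. So [A] can serve as the second
       component of a pair in [Tpairs], and [noT] applies after complementing. *)
    have dA : [disjoint a |: S & A].
      rewrite disjoint_sym; move: dAB; rewrite !disjoints_subset => dAB.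
      apply/subsetP=> x xA; move/subsetP/(_ x xA): (dAB).
      have bA : b \notin A.
        by apply/negP=> /(subsetP dAB); rewrite !inE eqxx.
      rewrite !inE !negb_or => /andP[_ ->]; rewrite andbT.
      by apply: contraNneq bA => xa; rewrite -eA -xa.
    have := noT S A sS tsB eA tA dA.
    by rewrite (obs_sym obs tA tB) (obs_sym obs tA tsB) => ?; lra.
- have aB : a \notin B by apply: disjP dAB _; rewrite eA !inE eqxx.
  rewrite eA imset_tpermU1 // in tA tsA dAB *.
  case: (set_pair_cases a b B) => [eB|[S' sS' eB]|[S' sS' eB]].
  + by rewrite imset_tperm_id // noT.
  + by rewrite eB !inE eqxx in aB.
  + rewrite eB imset_tpermU1 // in tB tsB dAB *.
    rewrite leNgt; apply/negP=> lt.
    suff : (S, S') \in Sstar k Q a b by rewrite S0 inE.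
    rewrite !inE /= lt sS sS' (card_team _ _ tA) ?notin //.
    rewrite (card_team _ _ tB) ?notin // !eqxx !andbT /=.
    by apply: disjointW dAB; apply: subsetU1.
- have bB : b \notin B by apply: disjP dAB _; rewrite eA !inE eqxx.
  (* The two teams are changed one after the other. The intermediate teams may share the player [a],
     which is harmless because monotonicity of [Q] holds for overlapping teams too. *)
  apply: le_trans (rB _ _ tsA tB bB).
  rewrite eA imset_tpermU1 // in tA tsA *.
  by apply: (P_obs_monol obs) => //; apply: up.
Qed.

(** The inequality for [B] against [A] is, after complementing, the reverse of the one for [A]
    against [B]. *)
Lemma no_witness_tperm P Q gt a b : P_obs k P Q gt ->
  a != b -> player_gt k gt a b -> Sstar k Q a b = set0 -> Tstar k Q a b = set0 ->
  forall A B, A \in teams n k -> B \in teams n k -> [disjoint A & B] ->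
    Q (tperm a b @: A) (tperm a b @: B) = Q A B.
Proof.
move=> obs nab pab S0 T0 A B tA tB dAB.
have le_s := no_witness_tperm_le obs nab pab S0 T0.
have := le_s A B tA tB dAB.
have := le_s B A tB tA; rewrite disjoint_sym => /(_ dAB).
rewrite (obs_sym obs tB tA) (obs_sym obs (A := _ @: B)) ?teams_imset // => ? ?.
by lra.
Qed.

(** * Compatible orders in the presence of a witness *)

Hypothesis k_gt0 : (0 < k)%N.

Lemma witness_player_gt P Q gt a b : P_obs k P Q gt -> a != b ->
  Sstar k P a b :|: Tstar k P a b != set0 -> player_gt k gt a b.
Proof.
move=> obs nab /set0Pn[[S T] wit].
have [//|pba] := obs_consistent obs nab.
have notin := @subsetC2_notin 'I_n a b.
have disjU1 x (C D : {set 'I_n}) :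
    x \notin D -> [disjoint C & D] -> [disjoint x |: C & D].
  by move=> xD; rewrite !disjoints_subset subUset sub1set inE xD.
have tU x C : x \notin C -> #|C| = k.-1 -> x |: C \in teams n k.
  exact: teams_setU1.
have down C : C \subset ~: [set a; b] -> #|C| = k.-1 -> gt (b |: C) (a |: C).
  by rewrite setUC => sC cC; apply: pba.
move: wit; rewrite !inE /= => /orP[] /andP[/and5P[sS sT dST /eqP cS /eqP cT]].
- have aST : [disjoint a |: S & b |: T].
    rewrite disjU1 // ?inE ?negb_or ?nab ?notin //.
    by rewrite disjoint_sym disjU1 ?notin // disjoint_sym.
  have bST : [disjoint b |: S & a |: T].
    rewrite disjU1 // ?inE ?negb_or 1?eq_sym ?nab ?notin //.
    by rewrite disjoint_sym disjU1 ?notin // disjoint_sym.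
  rewrite -!(obs_agree obs) ?tU ?notin // ltNge => /negP[].
  (* The intermediate teams share [b], so this duel is unobservable; its value comes from the
     completed matrix [Q]. Both steps replace [a] by [b] or conversely in one team, using that [b]
     beats [a]. *)
  apply: (@le_trans _ _ (Q (b |: S) (b |: T))).
    by apply: (P_obs_monol obs); rewrite ?tU ?down ?notin.
  by apply: (P_obs_monor obs); rewrite ?tU ?down ?notin.
- have tT : T \in teams n k by rewrite inE cT.
  rewrite -!(obs_agree obs) ?tU ?disjU1 ?notin // ltNge => /negP[].
  by apply: (P_obs_monol obs); rewrite ?tU ?down ?notin.
Qed.

End Instances.

Theorem theorem1 (R : realFieldType) (n k : nat) (hk1 : (1 <= k)%N)
    (hkn : (2 * k <= n)%N)
    (P : {set 'I_n} -> {set 'I_n} -> R) (gt : rel {set 'I_n})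
    (hinst : dueling_instance k P gt)
    (a b : 'I_n) (hab : a != b) :
  deducible k P a b <-> Sstar k P a b :|: Tstar k P a b != set0.
Proof.
have obs := dueling_instance_P_obs hinst.
split=> [[S [sS cS ded]]|wit].
- have tSa : a |: S \in teams n k by rewrite teams_setU1 ?(subsetC2_notin sS).
  have tSb : b |: S \in teams n k by rewrite teams_setU1 ?(subsetC2_notin sS).
  have gtS : gt (a |: S) (b |: S) by apply: ded; exists P.
  have ngtS := P_obs_asym obs tSa tSb gtS.
  apply: contraNneq ngtS => wit0.
  have [S0 T0] : Sstar k P a b = set0 /\ Tstar k P a b = set0.
    by split; apply/eqP; rewrite -subset0 -wit0 ?subsetUl ?subsetUr.
  (* Consistency extends the comparison at the single set [S] to all sets. *)
  have pab : player_gt k gt a b.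
    case: (obs_consistent obs hab) => // /(_ S).
    rewrite setUC => /(_ sS cS) gtS'.
    by have := P_obs_asym obs tSa tSb gtS; rewrite gtS'.
  have obs_s := P_obs_imset obs (no_witness_tperm obs hab pab S0 T0).
  (* In the relabelled order, [a |: S] above [b |: S] means [b |: S] above [a |: S] in [gt], the
     sought contradiction. *)
  have := ded _ (ex_intro _ _ obs_s).
  by rewrite !imset_tpermU1.
(* The witness fixes the player order in every compatible [gt'], so any admissible set would do; its
   first component is one, whichever kind of witness it is. *)
- have [[S T]] := set0Pn _ wit.
  rewrite !inE /= => /orP[] /andP[/and5P[sS _ _ /eqP cS _] _]; exists S;
    by split=> // gt' [P' obs']; apply: (witness_player_gt hk1 obs' hab wit).
Qed.
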